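(* (a) For a given $\gamma\in\mathbb{R}_+$, the Penalized Dual estimator $$\widehat\pi^\star_\gamma=\left[\{p_{\theta_1}(\widehat w_\gamma)\}^{\gamma},\dots,\{p_{\theta_m}(\widehat w_\gamma)\}^{\gamma}\right]^T$$ is one EM-step from the candidate estimator $\widehat\pi^\dagger_\gamma$; consequently, $\widehat\pi^\star_\gamma$ yields a higher likelihood value. (b) The estimators are in the unit simplex: $\widehat\pi^\star_{j,\gamma}\in[0,1]$ for $j=1,\dots,m$ and $\sum_{j=1}^m\widehat\pi^\star_{j,\gamma}=1$. (c) The Penalized Dual solution $\widehat w_\gamma$ satisfies $p_{\theta_j}(\widehat w_\gamma)\le 1$ for $j=1,\dots,m$, and hence the estimator $\widehat\pi^\star_\gamma$ remains in the feasible region defined by the dual constraints $\sum_{i=1}^d w_i f_\theta(y_i)\le 1$ for $\theta\in\Omega$.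
   Context: $\mathbb{R}_+$ denotes the positive reals. $y_1,\dots,y_d$ are the distinct observed data vectors, $y_i$ occurring $n_i$ times in the sample, and $n=\sum_{i=1}^d n_i$. $\{f_\theta:\theta\in\Omega\}$, $\Omega\subset\mathbb{R}^p$, is a family of probability densities, with $f_\theta(x)$ bounded in $\theta$ for each $x$, and $\Theta_m=\{\theta_1,\dots,\theta_m\}\subset\Omega$ is a fixed finite support set. The fixed support mixture problem is to maximize, over $\pi$ in the unit simplex of $\mathbb{R}^m$, the loglikelihood $l(\pi)=\sum_{i=1}^d n_i\log\big(\sum_{j=1}^m\pi_j f_{\theta_j}(y_i)\big)$. Its dual problem is to maximize $\sum_{i=1}^d n_i\log w_i$ subject to $w=(w_1,\dots,w_d)^T\in\mathbb{R}_+^d$ and $\sum_{i=1}^d w_i f_\theta(y_i)\le 1$ for $\theta\in\Omega$. For $w\in\mathbb{R}_+^d$ the constraint function is $p_{\theta_j}(w)=\sum_{i=1}^d w_i f_{\theta_j}(y_i)>0$. For $\gamma\in\mathbb{R}_+$, the Penalized Dual solution $\widehat w_\gamma=(\widehat w_{1,\gamma},\dots,\widehat w_{d,\gamma})^T$ is the maximizer over $w\in\mathbb{R}_+^d$ of $$\mathcal{H}_\gamma(w)=\sum_{i=1}^d\frac{n_i}{n}\log w_i-\frac1\gamma\sum_{j=1}^m\{p_{\theta_j}(w)\}^\gamma,$$ found by solving $\frac{n_i}{n}\frac1{w_i}-\sum_{j=1}^m\{p_{\theta_j}(w)\}^{\gamma-1}f_{\theta_j}(y_i)=0$ for $i=1,\dots,d$.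 The components of the Penalized Dual estimator are $\widehat\pi^\star_{j,\gamma}=\{p_{\theta_j}(\widehat w_\gamma)\}^\gamma$, and the candidate estimator $\widehat\pi^\dagger_\gamma$ has components $$\widehat\pi^\dagger_{j,\gamma}=\frac{\{p_{\theta_j}(\widehat w_\gamma)\}^{\gamma-1}}{\sum_{k=1}^m\{p_{\theta_k}(\widehat w_\gamma)\}^{\gamma-1}},\qquad j=1,\dots,m.$$ One EM-step from $\pi$ gives the vector with components $\pi_j\sum_{i=1}^d\frac{n_i}{n}\,\frac{f_{\theta_j}(y_i)}{\sum_{k=1}^m\pi_k f_{\theta_k}(y_i)}$, $j=1,\dots,m$.
   Formalization: In (c), feasibility is stated for the constraints with θ in the support set Θ_m instead of all θ∈Ω, where the claim can fail; in (a), ''higher likelihood'' means at least as high, and strictly higher unless the estimator equals the candidate estimator. *)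

(* Defs.v *)
(* MathComp / MathComp-Analysis. *)
From HB Require Import structures.
From mathcomp Require Export all_boot all_order all_algebra.
From mathcomp Require Export all_classical all_reals all_analysis.

Set Implicit Arguments.
Unset Strict Implicit.
Unset Printing Implicit Defensive.

Import Order.TTheory GRing.Theory Num.Theory numFieldNormedType.Exports.
Local Open Scope classical_set_scope.
Local Open Scope ring_scope.

(* The reference measure [mu] on the sample space is arbitrary, so that both
   discrete and continuous models are covered. *)
Definition is_density (disp : measure_display) (X : measurableType disp)
    (R : realType) (mu : {measure set X -> \bar R}) (g : X -> R) : Prop :=
  [/\ measurable_fun setT g, forall x, 0 <= g x
    & (\int[mu]_x (g x)%:E = 1)%E].

(* [f] is a total function on R^p; only its values on [Omega] are
   constrained. *)
Definition bounded_density_family (disp : measure_display)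
    (X : measurableType disp) (R : realType) (mu : {measure set X -> \bar R})
    (p : nat) (Omega : set 'cV[R]_p) (f : 'cV[R]_p -> X -> R) : Prop :=
  (forall th, Omega th -> is_density mu (f th)) /\
  (forall x, exists M : R, forall th, Omega th -> `|f th x| <= M).

Definition positive_orthant (R : realType) (d : nat) : set 'cV[R]_d :=
  [set w | forall i, 0 < w i 0].

(* Below, [y] lists the distinct observations, [cnt i] is the number of
   occurrences of [y i] in the sample, and [theta] lists the fixed support. *)

Definition sample_size (d : nat) (cnt : 'I_d -> nat) : nat :=
  (\sum_(i < d) cnt i)%N.

Definition freq (R : realType) (d : nat) (cnt : 'I_d -> nat) (i : 'I_d) : R :=
  (cnt i)%:R / (sample_size cnt)%:R.

Definition mixture_density (R : realType) (X : Type) (p m : nat)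
    (f : 'cV[R]_p -> X -> R) (theta : 'I_m -> 'cV[R]_p)
    (q : 'cV[R]_m) (x : X) : R :=
  \sum_(j < m) q j 0 * f (theta j) x.

(* [ln] is the real logarithm with the convention [ln 0 = 0], so this is the
   loglikelihood only at those [q] whose mixture density is positive at every
   observation. *)
Definition loglik (R : realType) (X : Type) (p d m : nat)
    (f : 'cV[R]_p -> X -> R) (y : 'I_d -> X) (cnt : 'I_d -> nat)
    (theta : 'I_m -> 'cV[R]_p) (q : 'cV[R]_m) : R :=
  \sum_(i < d) (cnt i)%:R * ln (mixture_density f theta q (y i)).

Definition constraint_fun (R : realType) (X : Type) (p d : nat)
    (f : 'cV[R]_p -> X -> R) (y : 'I_d -> X)
    (th : 'cV[R]_p) (w : 'cV[R]_d) : R :=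
  \sum_(i < d) w i 0 * f th (y i).

(* Feasible region of the dual problem over the parameter set [A]. The dual of
   the mixture problem with fixed support [theta] has [A := range theta]. *)
Definition dual_feasible (R : realType) (X : Type) (p d : nat)
    (f : 'cV[R]_p -> X -> R) (y : 'I_d -> X)
    (A : set 'cV[R]_p) : set 'cV[R]_d :=
  [set w | positive_orthant w /\
           forall th, A th -> constraint_fun f y th w <= 1].

Definition penalized_dual_objective (R : realType) (X : Type) (p d m : nat)
    (f : 'cV[R]_p -> X -> R) (y : 'I_d -> X) (cnt : 'I_d -> nat)
    (theta : 'I_m -> 'cV[R]_p) (gamma : R) (w : 'cV[R]_d) : R :=
  \sum_(i < d) freq R cnt i * ln (w i 0)
  - gamma^-1 * \sum_(j < m) constraint_fun f y (theta j) w `^ gamma.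

Definition penalized_dual_solution (R : realType) (X : Type) (p d m : nat)
    (f : 'cV[R]_p -> X -> R) (y : 'I_d -> X) (cnt : 'I_d -> nat)
    (theta : 'I_m -> 'cV[R]_p) (gamma : R) (w : 'cV[R]_d) : Prop :=
  positive_orthant w /\
  forall v, positive_orthant v ->
    penalized_dual_objective f y cnt theta gamma v
    <= penalized_dual_objective f y cnt theta gamma w.

Definition penalized_dual_estimator (R : realType) (X : Type) (p d m : nat)
    (f : 'cV[R]_p -> X -> R) (y : 'I_d -> X) (theta : 'I_m -> 'cV[R]_p)
    (gamma : R) (w : 'cV[R]_d) : 'cV[R]_m :=
  \col_(j < m) (constraint_fun f y (theta j) w `^ gamma).

Definition candidate_estimator (R : realType) (X : Type) (p d m : nat)
    (f : 'cV[R]_p -> X -> R) (y : 'I_d -> X) (theta : 'I_m -> 'cV[R]_p)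
    (gamma : R) (w : 'cV[R]_d) : 'cV[R]_m :=
  \col_(j < m) (constraint_fun f y (theta j) w `^ (gamma - 1)
    / \sum_(k < m) constraint_fun f y (theta k) w `^ (gamma - 1)).

Definition em_step (R : realType) (X : Type) (p d m : nat)
    (f : 'cV[R]_p -> X -> R) (y : 'I_d -> X) (cnt : 'I_d -> nat)
    (theta : 'I_m -> 'cV[R]_p) (q : 'cV[R]_m) : 'cV[R]_m :=
  \col_(j < m) (q j 0 * \sum_(i < d) freq R cnt i *
    (f (theta j) (y i) / mixture_density f theta q (y i))).

(* Main.v *)
Require Import Defs.
From mathcomp Require Import all_boot all_order all_algebra.
From mathcomp Require Import all_classical all_reals all_analysis.
From mathcomp Require Import ring.

Set Implicit Arguments.
Unset Strict Implicit.
Unset Printing Implicit Defensive.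

Import Order.TTheory GRing.Theory Num.Theory numFieldNormedType.Exports.
Local Open Scope classical_set_scope.
Local Open Scope ring_scope.

(** Write [c j] for the constraint function of [theta j] at the maximizer [w]
    and [a i j] for [f (theta j) (y i)]. Everything follows from the
    stationarity equations
      [freq i / w i = \sum_j c j `^ (gamma - 1) * a i j],
    proved in [penalized_dual_stationary].

    The right-hand side is, up to the normalizing constant [S] of the
    candidate estimator, its mixture density at [y i]. So that density equals
    [freq i / (w i * S)], and the factor by which an EM-step multiplies the
    [j]-th candidate weight is [S * \sum_i w i * a i j = S * c j]: the EM-step
    turns [c j `^ (gamma - 1) / S] into [c j `^ gamma].

    Multiplying the [i]-th equation by [w i] and summing over [i] gives
    [\sum_j c j `^ gamma = 1]. Hence each [c j `^ gamma], and with it each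
    [c j], is at most one.

    What remains is the classical fact that an EM-step from a point of the
    simplex increases the likelihood, strictly unless the point is fixed
    ([em_step_loglik]). It combines Jensen's inequality for the logarithm
    ([jensen_ln]) with the positivity of relative entropy
    ([relative_entropy_leif]), both consequences of [ln x <= x - 1]. *)

(** * Inequalities for the logarithm *)

Lemma ln_leif (R : realType) (x : R) :
  0 < x -> ln x <= x - 1 ?= iff (x == 1).
Proof.
move=> x0; have xE : x = expR (ln x) by rewrite lnK.
have [->|xn1] := eqVneq x 1; first by rewrite ln1 subrr; apply/leif_refl.
have ln_neq0 : ln x != 0 by apply: contra xn1 => /eqP lnx; rewrite xE lnx expR0.
have lt_ln : ln x < x - 1 by rewrite ltrBrDl [ltRHS]xE expR_gt1Dx.
by split; [exact: ltW | rewrite lt_eqF].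
Qed.

(** This is [ln t <= t - 1] at [t = y / x], multiplied by [- x]. Summed over the
    entries of two probability vectors, the left-hand sides cancel and
    the right-hand sides add up to the relative entropy, which gives its
    positivity together with the equality case. The entries with [x = 0] are
    included thanks to the factor [x] of the logarithms. *)
Lemma relative_entropy_leif (R : realType) (x y : R) :
    0 <= x -> 0 <= y -> (y = 0 -> x = 0) ->
  x - y <= x * (ln x - ln y) ?= iff (x == y).
Proof.
move=> x0 y0 yx; have [xe|xn0] := eqVneq x 0.
  rewrite {1 2}xe mul0r sub0r; split; first by rewrite oppr_le0.
  by rewrite xe oppr_eq0 eq_sym.
have yn0 : y != 0 by apply: contra xn0 => /eqP/yx/eqP.
have xgt0 : 0 < x by rewrite lt_def xn0.
have ygt0 : 0 < y by rewrite lt_def yn0.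
have [le_ln eq_ln] := ln_leif (divr_gt0 ygt0 xgt0).
have -> : ln x - ln y = - ln (y / x) by rewrite ln_div ?posrE// opprB.
have xyE : x - y = x * - (y / x - 1) by field.
split; first by rewrite xyE ler_pM2l// lerN2.
rewrite {1}xyE (inj_eq (mulfI xn0)) eqr_opp eq_sym eq_ln.
by rewrite -(inj_eq (mulIf xn0)) divfK// mul1r eq_sym.
Qed.

Lemma weighted_mean_gt0 (R : realType) (I : finType) (r u : I -> R) :
    (forall j, 0 <= r j) -> \sum_j r j = 1 ->
    (forall j, 0 <= u j) -> (forall j, r j != 0 -> u j != 0) ->
  0 < \sum_j r j * u j.
Proof.
move=> r0 r1 u0 ru; have ru_ge0 j : 0 <= r j * u j by rewrite mulr_ge0.
rewrite lt_def sumr_ge0// andbT; apply/negP.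
rewrite psumr_eq0// => /allP ru0.
have /eqP := r1; rewrite big1 ?(eq_sym 0) ?oner_eq0// => j _.
apply/eqP/negPn/negP => rj; have := ru0 j (mem_index_enum _).
by rewrite mulf_eq0 (negPf rj) (negPf (ru j rj)).
Qed.

(** The tangent line of [ln] at the weighted mean [U] of [u] lies above [ln];
    averaging the tangent inequalities at the points [u j] makes the linear
    terms cancel. Points of weight zero may be zero, so that ratios of
    probability vectors with zero entries are covered. *)
Lemma jensen_ln (R : realType) (I : finType) (r u : I -> R) :
    (forall j, 0 <= r j) -> \sum_j r j = 1 ->
    (forall j, 0 <= u j) -> (forall j, r j != 0 -> u j != 0) ->
  \sum_j r j * ln (u j) <= ln (\sum_j r j * u j).
Proof.
move=> r0 r1 u0 ru; have U_gt0 := weighted_mean_gt0 r0 r1 u0 ru.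
set U := \sum_j r j * u j in U_gt0 *.
have -> : ln U = \sum_j r j * (ln U + (u j / U - 1)).
  under eq_bigr do rewrite mulrDr mulrBr mulr1 mulrA.
  rewrite big_split/= sumrB -!mulr_suml r1 mul1r -/U divff ?gt_eqF//.
  by rewrite subrr addr0.
apply: ler_sum => j _; have [->|rj] := eqVneq (r j) 0; first by rewrite !mul0r.
have uj : 0 < u j by rewrite lt_def ru// u0.
rewrite ler_wpM2l// -lerBlDl -ln_div ?posrE//.
by have [] := ln_leif (divr_gt0 uj U_gt0).
Qed.

(** * The likelihood along an EM-step *)

Lemma freq_ge0 (R : realType) (d : nat) (cnt : 'I_d -> nat) i :
  0 <= freq R cnt i.
Proof. by rewrite divr_ge0. Qed.

Lemma sum_freq (R : realType) (d : nat) (cnt : 'I_d -> nat) :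
  (0 < sample_size cnt)%N -> \sum_i freq R cnt i = 1.
Proof.
move=> n0; rewrite -mulr_suml -natr_sum divff//.
by rewrite pnatr_eq0 -lt0n.
Qed.

(** Write [F] for the empirical frequencies, [M] and [M'] for the mixture
    densities under [q] and its image [q'], and [r i j] for the posterior
    probability of component [j] given observation [y i], so that [q'] is the
    [F]-average of the rows of [r]. Since [M' i / M i] is the [r i]-mean of
    [q' j / q j], Jensen's inequality bounds the loglikelihood gain per
    observation from below by the relative entropy of [q'] with respect to
    [q]. That entropy is nonnegative, and positive unless [q' = q].

    Entries of [q] may vanish; they stay zero and contribute nothing. *)
Theorem em_step_loglik (R : realType) (X : Type) (p d m : nat)
    (f : 'cV[R]_p -> X -> R) (y : 'I_d -> X) (cnt : 'I_d -> nat)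
    (theta : 'I_m -> 'cV[R]_p) (q : 'cV[R]_m) :
    (0 < sample_size cnt)%N ->
    (forall i j, 0 <= f (theta j) (y i)) ->
    (forall j, 0 <= q j 0) -> \sum_j q j 0 = 1 ->
    (forall i, 0 < mixture_density f theta q (y i)) ->
  loglik f y cnt theta q <= loglik f y cnt theta (em_step f y cnt theta q) /\
  (em_step f y cnt theta q <> q ->
   loglik f y cnt theta q < loglik f y cnt theta (em_step f y cnt theta q)).
Proof.
move=> n_gt0 f0 q0 q1 M0; set q' := em_step f y cnt theta q.
set M := fun i => mixture_density f theta q (y i).
set M' := fun i => mixture_density f theta q' (y i).
pose F := freq R cnt.
pose r i j := q j 0 * f (theta j) (y i) / M i.
have r_ge0 i j : 0 <= r i j by rewrite divr_ge0 ?mulr_ge0// ltW ?M0.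
have r_sum i : \sum_j r i j = 1 by rewrite -mulr_suml divff// gt_eqF ?M0.
have q'E j : q' j 0 = \sum_i F i * r i j.
  rewrite mxE big_distrr/=; apply: eq_bigr => i _.
  by rewrite /r /F mulrCA !mulrA.
have q'_ge0 j : 0 <= q' j 0.
  by rewrite q'E; apply: sumr_ge0 => i _; rewrite mulr_ge0 ?freq_ge0.
have q'_sum : \sum_j q' j 0 = 1.
  under eq_bigr do rewrite q'E.
  rewrite exchange_big/= -[RHS](sum_freq R n_gt0); apply: eq_bigr => i _.
  by rewrite -mulr_sumr r_sum mulr1.
have q_q' j : q j 0 = 0 -> q' j 0 = 0 by rewrite mxE => ->; rewrite mul0r.
have jensen i : \sum_j F i * r i j * (ln (q' j 0) - ln (q j 0)) <=
    F i * (ln (M' i) - ln (M i)).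
  have [Fi|Fi] := eqVneq (F i) 0.
    by rewrite Fi mul0r big1// => j _; rewrite !mul0r.
  (* Both weights are positive wherever the posterior is, so that [ln_div]
     applies to all terms that count. *)
  have r_pos j : r i j != 0 -> 0 < q j 0 /\ 0 < q' j 0.
    move=> rij; split.
      by rewrite lt_def q0 andbT; apply: contra rij => /eqP qj; rewrite /r qj !mul0r.
    rewrite lt_def q'_ge0 andbT q'E psumr_eq0; last first.
      by move=> k _; rewrite mulr_ge0 ?freq_ge0.
    apply/negP => /allP/(_ i (mem_index_enum _)).
    by rewrite mulf_eq0 (negPf Fi) (negPf rij).
  (* At [q j 0 = 0] the ratio is the junk value [0], which agrees with the
     term [q' j 0 * _ = 0] of [M' i]. *)
  have mix_ratio : \sum_j r i j * (q' j 0 / q j 0) = M' i / M i.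
    rewrite mulr_suml; apply: eq_bigr => j _.
    have [qj|qj] := eqVneq (q j 0) 0; first by rewrite q_q'// !mul0r mulr0.
    by rewrite /r; field; rewrite qj gt_eqF ?M0.
  have u_ge0 j : 0 <= q' j 0 / q j 0 by rewrite divr_ge0.
  have u_neq0 j : r i j != 0 -> q' j 0 / q j 0 != 0.
    by move=> /r_pos[qj q'j]; rewrite gt_eqF// divr_gt0.
  have := jensen_ln (r_ge0 i) (r_sum i) u_ge0 u_neq0.
  rewrite mix_ratio => le_ln.
  have M'_gt0 : 0 < M' i.
    have := weighted_mean_gt0 (r_ge0 i) (r_sum i) u_ge0 u_neq0.
    by rewrite mix_ratio pmulr_lgt0// invr_gt0 M0.
  under eq_bigr do rewrite -mulrA.
  rewrite -mulr_sumr ler_wpM2l ?freq_ge0// -ln_div ?posrE ?M0//.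
  apply: le_trans le_ln; apply: ler_sum => j _.
  have [->|/r_pos[qj q'j]] := eqVneq (r i j) 0; first by rewrite !mul0r.
  by rewrite ln_div ?posrE.
have loglikE v : loglik f y cnt theta v =
    (sample_size cnt)%:R * \sum_i F i * ln (mixture_density f theta v (y i)).
  rewrite mulr_sumr; apply: eq_bigr => i _.
  by rewrite /F /freq mulrA mulrCA divff ?mulr1// pnatr_eq0 -lt0n.
have [gibbs_le gibbs_eq] := leif_sum (fun j (_ : true) =>
  relative_entropy_leif (q'_ge0 j) (q0 j) (@q_q' j)).
have jensen_sum : \sum_j q' j 0 * (ln (q' j 0) - ln (q j 0)) <=
    \sum_i F i * ln (M' i) - \sum_i F i * ln (M i).
  rewrite -sumrB; under eq_bigr do rewrite {1}q'E mulr_suml.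
  rewrite exchange_big/=; apply: ler_sum => i _.
  by rewrite -mulrBr; exact: jensen.
move: gibbs_le gibbs_eq; rewrite sumrB q'_sum q1 subrr => gibbs_le gibbs_eq.
split=> [|q'q]; first by rewrite !loglikE ler_wpM2l// -subr_ge0 (le_trans gibbs_le).
rewrite !loglikE ltr_pM2l ?ltr0n// -subr_gt0 (lt_le_trans _ jensen_sum)//.
rewrite lt_def gibbs_le andbT eq_sym gibbs_eq; apply/negP => /forallP q'qj.
by apply: q'q; apply/colP => j; exact/eqP/q'qj.
Qed.

(** * First-order condition of the Penalized Dual *)

(** The positive orthant is open, so the objective restricted to a coordinate
    line through its maximizer has derivative zero there. The derivative of
    the penalty exists because the constraint functions stay positive along
    the line, which keeps [powR] away from zero. *)
Lemma penalized_dual_stationary (R : realType) (X : Type) (p d m : nat)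
    (f : 'cV[R]_p -> X -> R) (y : 'I_d -> X) (cnt : 'I_d -> nat)
    (theta : 'I_m -> 'cV[R]_p) (gamma : R) (w : 'cV[R]_d) :
    (forall v j, positive_orthant v -> 0 < constraint_fun f y (theta j) v) ->
    0 < gamma -> penalized_dual_solution f y cnt theta gamma w ->
  forall i, freq R cnt i / w i 0 =
    \sum_j constraint_fun f y (theta j) w `^ (gamma - 1) * f (theta j) (y i).
Proof.
move=> constraint_gt0 gamma_gt0 [w_gt0 w_max] i.
pose c j := constraint_fun f y (theta j) w.
pose a j := f (theta j) (y i).
pose v (t : R) : 'cV[R]_d := w + t *: delta_mx i 0.
have vE t k : v t k 0 = w k 0 + t * (k == i)%:R by rewrite !mxE eqxx andbT.
have vi t : v t i 0 = w i 0 + t by rewrite vE eqxx mulr1.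
have vk t k : k != i -> v t k 0 = w k 0.
  by move=> ki; rewrite vE (negPf ki) mulr0 addr0.
have cv t j : constraint_fun f y (theta j) (v t) = c j + t * a j.
  rewrite /c /constraint_fun (bigD1 i)//= [in RHS](bigD1 i)//= vi.
  rewrite (eq_bigr (fun k => w k 0 * f (theta j) (y k))); last first.
    by move=> k ki; rewrite vk.
  by rewrite mulrDl addrAC.
have v_gt0 t : - w i 0 < t -> positive_orthant (v t).
  move=> wt k; have [->|ki] := eqVneq k i; last by rewrite vk.
  by rewrite vi -ltrBlDl sub0r.
pose K := \sum_(k < d | k != i) freq R cnt k * ln (w k 0).
pose g (t : R) := freq R cnt i * ln (w i 0 + t) + K
  - gamma^-1 * \sum_j (c j + t * a j) `^ gamma.
have gE t : g t = penalized_dual_objective f y cnt theta gamma (v t).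
  rewrite /penalized_dual_objective (bigD1 i)//= vi.
  under [in RHS]eq_bigr => k ki do rewrite vk//.
  by congr (_ - _ * _); apply: eq_bigr => j _; rewrite cv.
have dg (t : R) : - w i 0 < t -> is_derive t 1 g (freq R cnt i / (w i 0 + t)
    - \sum_j (c j + t * a j) `^ (gamma - 1) * a j).
  move=> wt.
  have wt0 : 0 < w i 0 + t by rewrite -ltrBlDl sub0r.
  have ct0 j : 0 < c j + t * a j by rewrite -cv; exact/constraint_gt0/v_gt0.
  have dln : is_derive t 1 (fun s => ln (w i 0 + s)) ((w i 0 + t)^-1 * 1).
    apply: (@is_derive1_comp _ (@ln R) (fun s => w i 0 + s)).
      exact: is_derive1_ln.
    have -> : +%R (w i 0) = cst (w i 0) + id :> (R -> R) by [].
    by apply: is_derive_eq; rewrite add0r mulr1.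
  have dpow j : is_derive t 1 (fun s => (c j + s * a j) `^ gamma)
      (gamma * (c j + t * a j) `^ (gamma - 1) * a j).
    apply: (@is_derive1_comp _ (fun x => x `^ gamma) (fun s => c j + s * a j)).
      exact: is_derive1_powR.
    have -> : (fun s : R => c j + s * a j) = cst (c j) + a j *: id.
      by apply/funext => s /=; rewrite !fctE/= /GRing.scale/= mulrC.
    by apply: is_derive_eq; rewrite add0r /GRing.scale/= mulr1.
  have dsum := is_derive_sum dpow.
  have -> : g = (freq R cnt i *: (fun s => ln (w i 0 + s)) + cst K)
      - gamma^-1 *: (\sum_(j < m) (fun s => (c j + s * a j) `^ gamma)).
    by apply/funext => s; rewrite /g !fctE/= fct_sumE.
  apply: is_derive_eq; rewrite /GRing.scale/= addr0 mulr1; congr (_ - _).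
  rewrite mulr_sumr; apply: eq_bigr => j _.
  by rewrite -!mulrA mulKf// gt_eqF.
have d0 : is_derive (0 : R) 1 g 0.
  have wi0 := w_gt0 i.
  (* The line stays in the orthant for all [t > - w i 0]; the right end of the
     interval is arbitrary. *)
  apply: (@derive1_at_max _ g (- w i 0) 1 0).
  - by rewrite (le_trans _ ler01)// oppr_le0 ltW.
  - by move=> t; rewrite in_itv/= => /andP[wt _]; have [] := dg t wt.
  - by rewrite in_itv/= oppr_lt0 wi0 ltr01.
  - move=> t; rewrite in_itv/= => /andP[wt _]; rewrite !gE.
    have -> : v 0 = w by rewrite /v scale0r addr0.
    exact/w_max/v_gt0.
have lt_w0 : - w i 0 < 0 by rewrite oppr_lt0.
have := @derive_val _ _ _ _ _ _ _ (dg 0 lt_w0).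
rewrite (@derive_val _ _ _ _ _ _ _ d0) addr0.
move=> /esym/eqP; rewrite subr_eq0 => /eqP ->.
by apply: eq_bigr => j _; rewrite mul0r addr0.
Qed.

(** * The Penalized Dual estimator *)

Theorem theorem2 (R : realType) (disp : measure_display)
    (X : measurableType disp) (mu : {measure set X -> \bar R})
    (p d m : nat) (Omega : set 'cV[R]_p) (f : 'cV[R]_p -> X -> R)
    (y : 'I_d -> X) (cnt : 'I_d -> nat) (theta : 'I_m -> 'cV[R]_p)
    (gamma : R) (w : 'cV[R]_d)
    (d_gt0 : (0 < d)%N) (m_gt0 : (0 < m)%N)
    (f_dens : bounded_density_family mu Omega f)
    (y_inj : injective y) (cnt_gt0 : forall i, (0 < cnt i)%N)
    (theta_inj : injective theta) (theta_Omega : forall j, Omega (theta j))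
    (constraint_gt0 : forall (v : 'cV[R]_d) (j : 'I_m),
       positive_orthant v -> 0 < constraint_fun f y (theta j) v)
    (gamma_gt0 : 0 < gamma)
    (w_sol : penalized_dual_solution f y cnt theta gamma w) :
  let pi_star := penalized_dual_estimator f y theta gamma w in
  let pi_dag := candidate_estimator f y theta gamma w in
  [/\ (* (a) *)
      [/\ pi_star = em_step f y cnt theta pi_dag,
          loglik f y cnt theta pi_dag <= loglik f y cnt theta pi_star
        & pi_star <> pi_dag ->
          loglik f y cnt theta pi_dag < loglik f y cnt theta pi_star],
      (* (b) *)
      (forall j, 0 <= pi_star j 0 <= 1) /\ \sum_(j < m) pi_star j 0 = 1
    & (* (c) *)
      (forall j, constraint_fun f y (theta j) w <= 1) /\
      dual_feasible f y (range theta) w].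
Proof.
move=> pi_star pi_dag.
have [w_gt0 _] := w_sol.
have f_ge0 i j : 0 <= f (theta j) (y i).
  by have [/(_ _ (theta_Omega j))[]] := f_dens.
have n_gt0 : (0 < sample_size cnt)%N.
  by rewrite /sample_size (bigD1 (Ordinal d_gt0))//= addn_gt0 cnt_gt0.
have F_gt0 i : 0 < freq R cnt i by rewrite divr_gt0 ?ltr0n.
have stat := penalized_dual_stationary constraint_gt0 gamma_gt0 w_sol.
pose c j := constraint_fun f y (theta j) w.
have c_gt0 j : 0 < c j by exact: constraint_gt0.
pose S := \sum_k c k `^ (gamma - 1).
have S_gt0 : 0 < S.
  rewrite /S (bigD1 (Ordinal m_gt0))//= ltr_pwDl ?powR_gt0//.
  by apply: sumr_ge0 => k _; rewrite powR_ge0.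
have S_neq0 : S != 0 by rewrite gt_eqF.
have starE j : pi_star j 0 = c j `^ gamma by rewrite mxE.
have dagE j : pi_dag j 0 = c j `^ (gamma - 1) / S by rewrite mxE.
have mix_dag i : mixture_density f theta pi_dag (y i) = freq R cnt i / (w i 0 * S).
  rewrite invfM mulrA stat mulr_suml; apply: eq_bigr => j _.
  by rewrite dagE mulrAC.
have star_em : pi_star = em_step f y cnt theta pi_dag.
  apply/colP => j; rewrite starE mxE dagE -mulr_powRB1 ?ltW// mulrC -mulrA.
  congr (_ * _); rewrite mulr_sumr; apply: eq_bigr => i _.
  rewrite mix_dag; have := F_gt0 i; have := w_gt0 i => wi Fi.
  by field; rewrite S_neq0 !gt_eqF.
have dag_ge0 j : 0 <= pi_dag j 0 by rewrite dagE divr_ge0 ?powR_ge0// ltW.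
have dag_sum : \sum_j pi_dag j 0 = 1.
  by under eq_bigr do rewrite dagE; rewrite -mulr_suml divff.
have mix_dag_gt0 i : 0 < mixture_density f theta pi_dag (y i).
  by rewrite mix_dag divr_gt0// mulr_gt0.
have star_ge0 j : 0 <= pi_star j 0 by rewrite starE powR_ge0.
(* Sum over [i] of the stationarity equations multiplied by [w i 0]. *)
have star_sum : \sum_j pi_star j 0 = 1.
  rewrite -(sum_freq R n_gt0).
  transitivity (\sum_j \sum_i w i 0 * (c j `^ (gamma - 1) * f (theta j) (y i))).
    apply: eq_bigr => j _; rewrite starE -mulr_powRB1 ?ltW// mulr_suml.
    by apply: eq_bigr => i _; rewrite mulrAC mulrA.
  rewrite exchange_big/=; apply: eq_bigr => i _.
  by rewrite -mulr_sumr -stat mulrC divfK// gt_eqF.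
have star_le1 j : pi_star j 0 <= 1.
  by rewrite -star_sum (bigD1 j)//= lerDl sumr_ge0.
have c_le1 j : c j <= 1.
  rewrite leNgt; apply/negP => c1.
  have := gt0_ltr_powR gamma_gt0; move/(_ 1 (c j)).
  rewrite powR1 !nnegrE ler01 ltW// => /(_ isT isT c1).
  by rewrite -starE ltNge star_le1.
split.
- have := em_step_loglik n_gt0 f_ge0 dag_ge0 dag_sum mix_dag_gt0.
  by rewrite -star_em => -[le_l lt_l]; split.
- by split=> // j; rewrite star_ge0 star_le1.
- split; first exact: c_le1.
  by split=> [|_ [j _ <-]]; [exact: w_gt0 | exact: c_le1].
Qed.
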